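(* Let $n\geq 1$, let $m\geq p\geq 3$ be integers with $(m,p)\neq(4,3)$, and let $\Gamma=C_m$ be the cycle on $m$ vertices. If $(m,p)\neq(5,4)$, then \[\kappa_{\Gamma}(n,p)=\left\lceil\frac{pn}{p-1}\right\rceil,\] and if $(m,p)=(5,4)$, then $\kappa_{\Gamma}(n,p)=\left\lceil\frac{3n}{2}\right\rceil$.
   Context: All graphs are finite and simple. A matching $M$ of a graph $\Gamma=(V,E)$ is positive if there is a weight function $w\colon V\to\mathbb{R}$ such that for every edge $uv\in E$: $w(u)+w(v)>0$ if and only if $uv\in M$. A positive matching decomposition (pmd) of $\Gamma$ of size $p$ is an ordered partition $M_1,\ldots,M_p$ of $E$ into (nonempty) parts such that $M_i$ is a positive matching of $(V,E\setminus\bigcup_{j<i}M_j)$ for $i=1,\ldots,p$. For a set $M$ of edges, $\Gamma[M]$ denotes the subgraph of $\Gamma$ induced by the set $V(M)$ of end vertices of edges in $M$. A family $\mathcal{E}$ of subsets of $E(\Gamma)$ is an acyclic family of edge-sets (AFE) if the graph $\bigcup_{M\in\mathcal{E}}\Gamma[M]$ is acyclic. For a pmd $\mathcal{M}=\{M_1,\ldots,M_p\}$ of $\Gamma$, let $\mathrm{cov}_{\mathrm{AFE}}(n*\Gamma,\mathcal{M})$ be the minimum number $N$ of (not necessarily distinct) subfamilies $\mathcal{C}_1,\ldots,\mathcal{C}_N\subseteq\mathcal{M}$, each of which is an AFE, such that every $M_h$ belongs to at least $n$ of the $\mathcal{C}_k$ ($+\infty$ if there is no such $N$). Then \[\kappa_\Gamma(n,p):=\inf\{\mathrm{cov}_{\mathrm{AFE}}(n*\Gamma,\mathcal{M})\colon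 \mathcal{M}\text{ is a pmd of }\Gamma\text{ of size }p\}.\] *)

(* Defs.v *)
From HB Require Import structures.
From mathcomp Require Import all_boot all_order all_algebra.
From mathcomp Require Import reals constructive_ereal ereal.
From mathcomp Require classical_sets.

Set Implicit Arguments.
Unset Strict Implicit.
Unset Printing Implicit Defensive.

Import Order.TTheory GRing.Theory Num.Theory.

Local Open Scope ring_scope.

(* Finite simple graphs with vertices taken in T; an edge is the two-element
   set of its end vertices. *)
Record sgraph (T : finType) := SGraph {
  gvert : {set T};
  gedge : {set {set T}};
  gedgeP : forall e, e \in gedge -> e \subset gvert /\ #|e| = 2 }.

Section Graphs.
Variable T : finType.
Implicit Types (g : sgraph T) (F M : {set {set T}}) (A : {set T}).

Definition adj g : rel T := [rel x y | [set x; y]%SET \in gedge g].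

Lemma del_edges_subproof g F e :
  e \in gedge g :\: F -> e \subset gvert g /\ #|e| = 2.
Proof. by rewrite in_setD => /andP[_ /gedgeP]. Qed.

Definition del_edges g F := SGraph (@del_edges_subproof g F).

Lemma induced_subproof g A e :
  e \in [set e in gedge g | e \subset A]%SET ->
  e \subset gvert g :&: A /\ #|e| = 2.
Proof.
by rewrite inE subsetI => /andP[/gedgeP[-> ->] ->].
Qed.

Definition induced g A := SGraph (@induced_subproof g A).

Lemma bigunion_subproof (I : finType) (P : {set I}) (h : I -> sgraph T) e :
  e \in \bigcup_(i in P) gedge (h i) ->
  e \subset \bigcup_(i in P) gvert (h i) /\ #|e| = 2.
Proof.
move=> /bigcupP[i iP /gedgeP[sub ->]]; split=> //.
exact: (subset_trans sub (bigcup_sup i iP)).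
Qed.

Definition bigunion (I : finType) (P : {set I}) (h : I -> sgraph T) :=
  SGraph (@bigunion_subproof I P h).

(* [ucycle] also accepts the closed walk [:: x; y] along a single edge, which
   is not a cycle of a simple graph. *)
Definition acyclic g := forall c : seq T, ucycle (adj g) c -> (size c <= 2)%N.

Definition matching g M := M \subset gedge g /\ trivIset M.

Definition positive_matching (R : realType) g M :=
  matching g M /\
  exists w : T -> R, forall u v : T, [set u; v]%SET \in gedge g ->
    (0 < w u + w v <-> [set u; v]%SET \in M).

Definition parts p (M : 'I_p -> {set {set T}}) : {set {set {set T}}} :=
  [set M i | i : 'I_p]%SET.

(* [partition] forbids the empty block; injectivity makes the p parts
   pairwise disjoint and not merely equal or disjoint. *)
Definition pmd (R : realType) g p (M : 'I_p -> {set {set T}}) :=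
  [/\ injective M,
      partition (parts M) (gedge g)
    & forall i : 'I_p,
        positive_matching R
          (del_edges g (\bigcup_(j : 'I_p | (j < i)%N) M j)) (M i)].

Definition induced_by_edges g M := induced g (cover M).

Definition AFE g (C : {set {set {set T}}}) :=
  acyclic (bigunion C (induced_by_edges g)).

Definition AFE_covering g (n : nat) (P : {set {set {set T}}}) (N : nat)
    (C : 'I_N -> {set {set {set T}}}) :=
  [/\ forall k, C k \subset P,
      forall k, AFE g (C k)
    & forall M, M \in P -> (n <= #|[set k | M \in C k]%SET|)%N].

End Graphs.

(* [ordS i] is i + 1 modulo m.  The condition only matters for m = 1, where
   it removes the loop. *)
Definition cycle_edges (m : nat) : {set {set 'I_m}} :=
  [set [set i; ordS i]%SET | i : 'I_m & i != ordS i]%SET.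

Lemma cycle_edges_subproof m e :
  e \in cycle_edges m -> e \subset setT /\ #|e| = 2.
Proof.
by case/imsetP=> i; rewrite inE => ni ->; rewrite subsetT cards2 ni.
Qed.

Definition cycle_graph (m : nat) : sgraph 'I_m :=
  SGraph (@cycle_edges_subproof m).

Import classical_sets.

(* A set of natural numbers has its minimum as infimum, and the infimum of
   the empty set is +oo. *)
Definition cov_AFE (T : finType) (R : realType) (g : sgraph T) (n : nat)
    (P : {set {set {set T}}}) : \bar R :=
  ereal_inf [set x | exists2 N : nat,
    (exists C : 'I_N -> {set {set {set T}}}, AFE_covering g n P C)
    & x = (N%:R)%:E]%classic.

Definition kappa (T : finType) (R : realType) (g : sgraph T) (n p : nat) :
    \bar R :=
  ereal_inf [set x | exists2 M : 'I_p -> {set {set T}},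
    pmd R g M & x = cov_AFE R g n (parts M)]%classic.

(* Main.v *)
(* Lower bound: all the parts of a pmd together contain every edge of the
   cycle, so an AFE omits at least one part, and counting incidences gives
   p n <= N (p - 1).  For (m, p) = (5, 4) three of the four parts already
   induce the whole cycle.

   Upper bound: it is enough to find a pmd in which every part can be omitted.
   For m >= 5 the graph induced by a part contains an edge outside that part
   exactly when both neighbours of the edge lie in the part.  So omitting a
   part leaves an acyclic union as soon as one edge of that part has its two
   neighbours in different parts.  A proper edge-colouring of the cycle with
   this property for every colour is written down explicitly; for
   (m, p) = (5, 4) only colour 0 fails.  Positivity is easy: colour class 0 is
   an induced matching, and without it the remaining graph is a subgraph of a
   path.  Rotating the omitted part yields the optimal coverings. *)
Require Import Defs.
From HB Require Import structures.
From mathcomp Require Import all_boot all_order all_algebra.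
From mathcomp Require Import reals constructive_ereal ereal.
From mathcomp Require Import zify lra.

Set Implicit Arguments.
Unset Strict Implicit.
Unset Printing Implicit Defensive.

Import Order.TTheory GRing.Theory Num.Theory.
Local Open Scope ring_scope.

(** * Acyclicity and the edges of the cycle *)

Lemma acyclic_potential (T : finType) (g : sgraph T) (f : T -> nat) :
  injective f ->
  (forall x y, adj g x y -> f x = (f y).+1 \/ f y = (f x).+1) -> acyclic g.
Proof.
move=> f_inj step [//|x0 s0] cyc.
have x0c : x0 \in x0 :: s0 by rewrite mem_head.
(* On a cycle both neighbours of a vertex of maximal potential have potential one less, so they
   coincide by injectivity. *)
case: (arg_maxnP f x0c) => x /rot_to[i s rot_eq] x_max.
rewrite -(size_rot i) rot_eq; rewrite -(rot_ucycle i) rot_eq in cyc.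
have le_x y : y \in x :: s -> (f y <= f x)%N.
  by rewrite -rot_eq mem_rot => /x_max.
case: s cyc le_x {rot_eq} => [//|y s] /andP[/= /andP[exy]].
rewrite rcons_path => /andP[_ elx] /and3P[_ ys _] le_x.
have [le_y le_l] : (f y <= f x)%N /\ (f (last y s) <= f x)%N.
  by split; apply: le_x; rewrite in_cons ?mem_last ?mem_head orbT.
have /f_inj eq_yl : f y = f (last y s).
  move: le_y le_l (step _ _ exy) (step _ _ elx) {x_max le_x}.
  by move: (f x) (f y) (f (last y s)) => a b d; lia.
by case: s ys eq_yl {exy elx le_x le_l} => [//|z s] /= /negP ys def_y; case: ys;
  rewrite {1}def_y mem_last.
Qed.

Lemma val_ordS m (i : 'I_m) :
  nat_of_ord (ordS i) = if (i.+1 == m)%N then 0%N else i.+1.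
Proof.
case: eqP => [/= ->|/eqP ne]; first by rewrite modnn.
by rewrite /= modn_small // ltn_neqAle ne ltn_ord.
Qed.

Lemma val_ordS2 m (i : 'I_m) : (2 < m)%N ->
  nat_of_ord (ordS (ordS i)) =
  if (i.+1 == m)%N then 1%N else if (i.+2 == m)%N then 0%N else i.+2.
Proof.
by move=> m_gt2; rewrite !val_ordS; have := ltn_ord i; do !case: eqP; lia.
Qed.

Definition cycle_edge m (i : 'I_m) : {set 'I_m} := [set i; ordS i]%SET.

Section CycleEdges.
Variables (m : nat) (m_gt2 : (2 < m)%N).
Implicit Types i j : 'I_m.

Lemma ordS_neq i : ordS i != i.
Proof.
apply/eqP => /(congr1 val); rewrite [LHS]val_ordS /=.
by have := ltn_ord i; case: eqP; lia.
Qed.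

Lemma ordS2_neq i : ordS (ordS i) != i.
Proof.
apply/eqP => /(congr1 val); rewrite [LHS]val_ordS2 //=.
by have := ltn_ord i; do !case: eqP; lia.
Qed.

Lemma set2_cycle_edge u v i :
  [set u; v]%SET = cycle_edge i -> u = i /\ v = ordS i \/ u = ordS i /\ v = i.
Proof.
move=> /setP eq_uv.
have := eq_uv i; have := eq_uv (ordS i); have := eq_uv u; have := eq_uv v.
have := ordS_neq i; rewrite !inE !eqxx !orbT /= => ne /esym/orP hv /esym/orP hu.
by case: hu hv => /eqP-> [] /eqP->;
  rewrite !eqxx ?(negPf ne) ?(eq_sym i) ?(negPf ne) //=; auto.
Qed.

Lemma cycle_edge_inj : injective (@cycle_edge m).
Proof.
move=> i j /set2_cycle_edge[[] //|[-> /eqP]].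
by rewrite (negPf (ordS2_neq _)).
Qed.

Lemma gedge_cycleP e :
  reflect (exists i, e = cycle_edge i) (e \in gedge (cycle_graph m)).
Proof.
apply: (iffP imsetP) => [[i _ ->]|[i ->]]; first by exists i.
by exists i => //; rewrite inE eq_sym ordS_neq.
Qed.

Lemma cycle_edge_gedge i : cycle_edge i \in gedge (cycle_graph m).
Proof. by apply/gedge_cycleP; exists i. Qed.

Lemma card_cycle_edges : #|gedge (cycle_graph m)| = m.
Proof.
have -> : gedge (cycle_graph m) = [set cycle_edge i | i : 'I_m]%SET.
  apply/setP => e; apply/gedge_cycleP/imsetP => [[i ->]|[i _ ->]]; by exists i.
by rewrite card_imset ?card_ord //; apply: cycle_edge_inj.
Qed.

(** The orbit of [ordS] is a closed walk without repetition through at least three vertices. *)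
Lemma cycle_not_acyclic (g : sgraph 'I_m) :
  (forall i, cycle_edge i \in gedge g) -> ~ acyclic g.
Proof.
move=> all_e ac; have i : 'I_m by exists 0%N; exact: ltnW (ltnW m_gt2).
have ucyc : ucycle (adj g) (orbit (@ordS m) i).
  rewrite /ucycle orbit_uniq andbT.
  apply: sub_cycle (cycle_orbit (@ordS_inj m) i) => x y /= /eqP <-.
  exact: all_e.
suff : (3 <= size (orbit (@ordS m) i))%N by rewrite ltnNge ac.
apply: (@uniq_leq_size _ [:: i; ordS i; ordS (ordS i)]).
  have nS (k : 'I_m) : k != ordS k by rewrite eq_sym ordS_neq.
  by rewrite /= !inE negb_or !nS eq_sym ordS2_neq.
move=> x; rewrite !inE -fconnect_orbit => /or3P[] /eqP->.
- exact: connect0.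
- exact: fconnect1.
exact: (fconnect_iter _ 2).
Qed.

Lemma acyclic_path_subgraph (g : sgraph 'I_m) j :
  gedge g \subset gedge (cycle_graph m) -> cycle_edge j \notin gedge g ->
  acyclic g.
Proof.
move=> sub jg.
(* Position of [i] on the path from [ordS j] to [j] that is left after deleting edge [j]. *)
pose f i := if (j < i)%N then (i - j.+1)%N else (i + m - j.+1)%N.
apply: (@acyclic_potential _ g f) => [x y|x y exy].
  have := ltn_ord x; have := ltn_ord y; have := ltn_ord j.
  rewrite /f => ? ? ? fxy; apply: val_inj => /=; move: fxy.
  by case: (ltnP j x); case: (ltnP j y); lia.
have /gedge_cycleP[i e_i] := subsetP sub _ exy.
have ne_ij : nat_of_ord i != j.
  by apply: contra jg => /eqP/val_inj <-; rewrite -e_i.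
have fS : f (ordS i) = (f i).+1.
  rewrite /f val_ordS; case: eqP => ?; case: (ltnP j i) => ?; case: ltnP => ?;
    by have := ltn_ord i; have := ltn_ord j; lia.
by case: (set2_cycle_edge e_i) => -[-> ->]; auto.
Qed.
End CycleEdges.

(** * Counting incidences in coverings by acyclic families *)

Section Coverings.
Variables (T : finType) (g : sgraph T) (n : nat).
Implicit Types P Q : {set {set {set T}}}.

(** Double counting of the pairs of a member of [Q] and a family containing it: each family misses
    some member of [Q]. A [Q] smaller than [P] serves the exceptional case [(m, p) = (5, 4)]. *)
Lemma AFE_covering_bound P Q N (C : 'I_N -> {set {set {set T}}}) :
  AFE_covering g n P C -> Q \subset P ->
  (forall D : {set {set {set T}}},
     D \subset P -> AFE g D -> ~~ (Q \subset D)) ->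
  (#|Q| * n <= N * #|Q|.-1)%N.
Proof.
move=> [subC afeC covC] subQ notQ.
have le_count : (#|Q| * n <= \sum_(M in Q) #|[set k | M \in C k]|)%N.
  by rewrite -sum_nat_const leq_sum // => M /(subsetP subQ)/covC.
apply: leq_trans le_count _.
have -> : (\sum_(M in Q) #|[set k | M \in C k]%SET| =
           \sum_(k < N) #|Q :&: C k|)%N.
  rewrite (eq_bigr (fun M => \sum_(k < N) (M \in C k))%N) => [|M _]; last first.
    rewrite -sum1_card big_mkcond; apply: eq_bigr => k _.
    by rewrite inE; case: ifP.
  rewrite exchange_big; apply: eq_bigr => k _.
  rewrite -sum1_card big_mkcond [RHS]big_mkcond; apply: eq_bigr => M _.
  by rewrite inE; case: (M \in Q); case: (M \in C k).
rewrite -[X in (_ <= X * _)%N](card_ord N) -sum_nat_const leq_sum // => k _.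
have : Q :&: C k \proper Q.
  by rewrite properE subsetIl subsetI subxx notQ.
by move/proper_card; case: #|Q|.
Qed.

Lemma card_residue_class N q r :
  (0 < q)%N -> (#|[set k : 'I_N | k %% q == r]%SET| <= (N + q.-1) %/ q)%N.
Proof.
move=> q_gt0; set K := ((N + q.-1) %/ q)%N.
have [N0|N_gt0] := posnP N.
  by rewrite (leq_trans (max_card _)) // card_ord N0.
have K_gt0 : (0 < K)%N by rewrite divn_gt0 //; lia.
have ltK (k : 'I_N) : (k %/ q < K)%N.
  by rewrite ltn_divLR // /K; have := ltn_ord k; nia.
(* Within a residue class the quotient by [q] determines [k], and it takes at most [K] values, the
   ceiling of [N / q]. *)
pose f k := Ordinal (ltK k).
rewrite -(@card_in_imset _ _ f).
  by rewrite (leq_trans (max_card _)) // card_ord.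
move=> k l; rewrite !inE => /eqP k_r /eqP l_r [kl].
by apply: val_inj; rewrite /= (divn_eq k q) (divn_eq l q) k_r l_r kl.
Qed.

(* The k-th family omits the member [h (k mod q)], so that each member is
   omitted about N / q times. *)
Lemma AFE_covering_rotation P q (h : 'I_q -> {set {set T}}) N :
  (1 < q)%N -> injective h -> (forall i, h i \in P) ->
  (forall i, AFE g (P :\ h i)) -> (q * n <= N * q.-1)%N ->
  exists C : 'I_N -> {set {set {set T}}}, AFE_covering g n P C.
Proof.
move=> q_gt1 h_inj hP afe le_N.
have q_gt0 : (0 < q)%N by lia.
exists (fun k => P :\ h (Ordinal (ltn_pmod k q_gt0))); split=> //.
  by move=> k; apply: subD1set.
move=> M MP.
have [i h_i|no_i] := pickP (fun i => h i == M).
  have -> : [set k : 'I_N | M \in P :\ h (Ordinal (ltn_pmod k q_gt0))]%SET =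
            ~: [set k : 'I_N | (k %% q)%N == i]%SET.
    apply/setP => k; rewrite !inE MP andbT -(eqP h_i) (inj_eq h_inj) eq_sym.
    by [].
  rewrite cardsCs setCK card_ord.
  (* The inequality [q * n <= N * q.-1] gives [N / q <= N - n]; the right side is an integer, so
     rounding [N / q] up keeps the bound. *)
  by have := card_residue_class N i q_gt0; nia.
rewrite (eq_card (B := predT)) ?card_ord; first by nia.
by move=> k; rewrite !inE MP andbT eq_sym no_i.
Qed.

(** The inequality [q * n <= N * q.-1] says that [N] is at least [q n / (q - 1)], so the least such
    [N] is the ceiling. The exceptional case needs [q = 3] with [p = 4]. *)
Lemma kappa_eq_ceil (R : realType) p q :
  (1 < q)%N ->
  (forall M : 'I_p -> {set {set T}}, pmd R g M ->
     forall N (C : 'I_N -> {set {set {set T}}}),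
     AFE_covering g n (parts M) C -> (q * n <= N * q.-1)%N) ->
  (exists2 M : 'I_p -> {set {set T}}, pmd R g M &
     forall N, (q * n <= N * q.-1)%N ->
     exists C : 'I_N -> {set {set {set T}}}, AFE_covering g n (parts M) C) ->
  kappa R g n p = (Num.ceil (q%:R * n%:R / q.-1%:R : R))%:~R%:E.
Proof.
move=> q_gt1 lower [M pmdM upper].
set c := Num.ceil _.
have q1_gt0 : 0 < q.-1%:R :> R by rewrite ltr0n; lia.
have ceil_le N : (c <= N%:Z) = (q * n <= N * q.-1)%N.
  by rewrite ceil_le_int ler_pdivrMr // -pmulrn -!natrM ler_nat.
have c_ge0 : 0 <= c.
  by rewrite ceil_ge0 (lt_le_trans (ltrN10 _)) // divr_ge0 ?mulr_ge0 ?ler0n.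
have c_abs : c = `|c|%N%:Z by rewrite gez0_abs.
apply/eqP; rewrite eq_le; apply/andP; split.
  have [C covC] : exists C : 'I_(`|c|%N) -> _, AFE_covering g n (parts M) C.
    by apply: upper; rewrite -ceil_le -c_abs.
  apply: ge_ereal_inf; exists (cov_AFE R g n (parts M)); first by exists M.
  apply: ge_ereal_inf; exists (`|c|%N%:R)%:E.
    by exists `|c|%N => //; exists C.
  by rewrite lee_fin {2}c_abs -pmulrn.
apply/ereal_infP => _ [M' pmdM' ->]; apply/ereal_infP => _ [N [C covC] ->].
by rewrite lee_fin (pmulrn 1 N) ler_int ceil_le (lower _ pmdM' _ _ covC).
Qed.
End Coverings.

Lemma gedge_bigunion_induced (T : finType) (g : sgraph T)
    (D : {set {set {set T}}}) (M : {set {set T}}) e :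
  M \in D -> e \in gedge g -> e \subset cover M ->
  e \in gedge (bigunion D (induced_by_edges g)).
Proof. by move=> MD eg sub_e; apply/bigcupP; exists M => //; rewrite inE eg. Qed.

Lemma subset_cover (T : finType) (M : {set {set T}}) e :
  e \in M -> e \subset cover M.
Proof. by move=> eM; apply: (bigcup_sup e). Qed.

(** * Lower bounds for the cycle *)

Section LowerBound.
Variables (R : realType) (m p : nat) (m_gt2 : (2 < m)%N).
Variables (M : 'I_p -> {set {set 'I_m}}) (pmdM : pmd R (cycle_graph m) M).

Lemma pmd_edge_part (i : 'I_m) : exists h, cycle_edge i \in M h.
Proof.
case: pmdM => _ /and3P[/eqP cov _ _] _; have := cycle_edge_gedge m_gt2 i.
by rewrite -cov => /bigcupP[_ /imsetP[h _ ->] ?]; exists h.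
Qed.

Lemma pmd_part_gedge h : M h \subset gedge (cycle_graph m).
Proof.
case: pmdM => _ /and3P[/eqP <- _ _] _; apply: bigcup_sup.
exact: imset_f.
Qed.

Lemma pmd_part_disjoint h (i j : 'I_m) :
  cycle_edge i \in M h -> cycle_edge j \in M h -> i != j ->
  [disjoint cycle_edge i & cycle_edge j].
Proof.
case: pmdM => _ _ /(_ h) [[_ /trivIsetP triv] _] iM jM ne_ij.
by apply: triv => //; apply: contra ne_ij => /eqP/(cycle_edge_inj m_gt2)->.
Qed.

Lemma pmd_consecutive_parts h k (i : 'I_m) :
  cycle_edge i \in M h -> cycle_edge (ordS i) \in M k -> h != k.
Proof.
move=> iM SiM; apply/eqP => hk; rewrite -{}hk in SiM.
have := pmd_part_disjoint iM SiM; rewrite eq_sym ordS_neq // => /(_ isT).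
by move/disjointFr/(_ (set22 _ _)); rewrite set21.
Qed.

Lemma cycle_AFE_covering_bound n N (C : 'I_N -> {set {set {set 'I_m}}}) :
  AFE_covering (cycle_graph m) n (parts M) C -> (p * n <= N * p.-1)%N.
Proof.
case: (pmdM) => M_inj _ _ covC.
have <- : #|parts M| = p by rewrite card_imset ?card_ord.
apply: AFE_covering_bound covC (subxx _) _ => D _ afeD; apply/negP => sub.
apply: cycle_not_acyclic m_gt2 _ _ afeD => i.
have [h ih] := pmd_edge_part i.
apply: (gedge_bigunion_induced (M := M h)).
- by apply: (subsetP sub); apply: imset_f.
- exact: cycle_edge_gedge.
exact: subset_cover.
Qed.
End LowerBound.

(* Five edges in four parts: some part holds two edges [i] and [i + 2], hence
   its induced subgraph also contains [i + 1], and together with the parts of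
   [i + 3] and [i + 4] it covers the whole cycle. *)
Lemma C5_AFE_covering_bound (R : realType) (M : 'I_4 -> {set {set 'I_5}}) n N
    (C : 'I_N -> {set {set {set 'I_5}}}) :
  pmd R (cycle_graph 5) M ->
  AFE_covering (cycle_graph 5) n (parts M) C -> (3 * n <= N * 2)%N.
Proof.
move=> pmdM covC; have five : (2 < 5)%N by [].
have [M_inj part_M _] := pmdM.
have [h two_h] : exists h, (1 < #|M h|)%N.
  apply/existsP; apply: contraT; rewrite negb_exists => /forallP le1.
  have : (#|gedge (cycle_graph 5)| <= 4)%N.
    rewrite (card_partition part_M) big_imset /=; last by move=> ? ? _ _ /M_inj.
    rewrite -[X in (_ <= X)%N](card_ord 4) -sum1_card leq_sum // => i _.
    by have := le1 i; rewrite -leqNgt.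
  by rewrite card_cycle_edges.
have [i [iM SSiM]] :
  exists i, cycle_edge i \in M h /\ cycle_edge (ordS (ordS i)) \in M h.
  have [e [f [eM fM ne_ef]]] := card_gt1P two_h.
  have /(gedge_cycleP five)[i e_i] := subsetP (pmd_part_gedge pmdM h) _ eM.
  have /(gedge_cycleP five)[j f_j] := subsetP (pmd_part_gedge pmdM h) _ fM.
  rewrite e_i f_j in eM fM ne_ef.
  have Si : ordS i != j.
    apply: contraTneq fM => <-.
    by apply/negP => /(pmd_consecutive_parts five pmdM eM)/eqP.
  have Sj : ordS j != i.
    apply: contraTneq eM => <-.
    by apply/negP => /(pmd_consecutive_parts five pmdM fM)/eqP.
  (* Two distinct edges of the 5-cycle that are not consecutive are two steps apart in one
     direction. *)
  have [SSi|SSj] : j = ordS (ordS i) \/ i = ordS (ordS j).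
    have : [|| i == j, ordS i == j, ordS j == i, j == ordS (ordS i)
             | i == ordS (ordS j)].
      by case: (i) (j) => [] [|[|[|[|[|[]]]]]] // ? [] [|[|[|[|[|[]]]]]] ?.
    rewrite (negPf Si) (negPf Sj) /=; case/or3P=> /eqP ij; [|by left|by right].
    by rewrite ij eqxx in ne_ef.
  - by exists i; rewrite -SSi.
  - by exists j; rewrite -SSj.
set j := ordS (ordS i) in SSiM.
have [k kM] := pmd_edge_part five pmdM (ordS j).
have [l lM] := pmd_edge_part five pmdM (ordS (ordS j)).
have cyc5 : ordS (ordS (ordS j)) = i.
  by apply: val_inj; rewrite /j; case: (i) => [] [|[|[|[|[|[]]]]]].
(* The edges [i + 2], [i + 3], [i + 4], [i] follow one another, so [h], [k], [l] are pairwise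
   distinct. *)
have ne_hk := pmd_consecutive_parts five pmdM SSiM kM.
have ne_kl := pmd_consecutive_parts five pmdM kM lM.
have ne_lh : l != h.
  by apply: (pmd_consecutive_parts five pmdM lM); rewrite cyc5.
pose Q : {set {set {set 'I_5}}} := [set M h; M k; M l]%SET.
have cardQ : #|Q| = 3.
  rewrite -[Q]setUA !cardsU1 cards1 !inE !(inj_eq M_inj) negb_or.
  by rewrite ne_hk ne_kl eq_sym ne_lh.
suff : (#|Q| * n <= N * #|Q|.-1)%N by rewrite cardQ.
apply: AFE_covering_bound covC _ _.
  by rewrite !subUset !sub1set !imset_f.
move=> D _ afeD; apply/negP; rewrite !subUset !sub1set.
case/andP=> /andP[hD kD] lD.
apply: cycle_not_acyclic five _ _ afeD => x.
have gx : cycle_edge x \in gedge (cycle_graph 5) by apply: cycle_edge_gedge.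
have in_part a : M a \in D -> cycle_edge x \in M a ->
    cycle_edge x \in gedge (bigunion D (induced_by_edges (cycle_graph 5))).
  by move=> aD xM; apply: (gedge_bigunion_induced aD) gx (subset_cover xM).
have : x \in [:: i; j; ordS j; ordS (ordS j); ordS i].
  by rewrite /j; case: (i) (x) => [] [|[|[|[|[|[]]]]]] // ? [] [|[|[|[|[|[]]]]]].
rewrite !inE => /or4P[|||/orP[]] /eqP def_x.
- by apply: (in_part h) => //; rewrite def_x.
- by apply: (in_part h) => //; rewrite def_x.
- by apply: (in_part k) => //; rewrite def_x.
- by apply: (in_part l) => //; rewrite def_x.
(* The last edge is [i + 1]: it shares one end with edge [i] and the other with edge [i + 2], both
   in [M h]. *)
apply: (gedge_bigunion_induced hD) => //; rewrite def_x.
rewrite subUset !sub1set.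
have /subsetP-> := subset_cover iM; rewrite ?set22 //.
by have /subsetP-> := subset_cover SSiM; rewrite ?set21.
Qed.

(** * Decompositions given by proper edge-colourings *)

Section Colouring.
Variables (R : realType) (m p : nat) (m_gt2 : (2 < m)%N) (c : 'I_m -> 'I_p).
Hypothesis c_proper : forall i, c (ordS i) != c i.

Definition colour_class (h : 'I_p) : {set {set 'I_m}} :=
  [set cycle_edge i | i : 'I_m & c i == h]%SET.

Lemma mem_colour_class h i : (cycle_edge i \in colour_class h) = (c i == h).
Proof.
apply/imsetP/idP => [[j jh /(cycle_edge_inj m_gt2)->]|ih].
  by rewrite inE in jh.
by exists i => //; rewrite inE.
Qed.

Lemma cover_colour_class h v :
  v \in cover (colour_class h) -> c v = h \/ exists2 a, v = ordS a & c a = h.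
Proof.
case/bigcupP=> _ /imsetP[a + ->]; rewrite !inE => /eqP ah /orP[] /eqP->.
  by left.
by right; exists a.
Qed.

(** Vertex [i] lies only on edge [i] and its predecessor, vertex [ordS i] only on the edges [i] and
    [ordS i]. *)
Lemma edge_sub_cover_colour_class h i :
  cycle_edge i \subset cover (colour_class h) ->
  c i = h \/ exists2 a, i = ordS a & c a = h /\ c (ordS i) = h.
Proof.
rewrite subUset !sub1set => /andP[/cover_colour_class[|[a i_a ah]]]; first by left.
case/cover_colour_class=> [Sih|[b /ordS_inj <-]]; last by left.
by right; exists a.
Qed.

(** Edge [ordS a] vanishes from the union: its own class is omitted, and no class contains both its
    neighbours, as their colours differ. What remains is a subgraph of a path. *)
Lemma AFE_omit_colour h a :
  c (ordS a) = h -> c a != c (ordS (ordS a)) ->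
  AFE (cycle_graph m) (parts colour_class :\ colour_class h).
Proof.
move=> Sah ne_c; apply: (acyclic_path_subgraph m_gt2 (j := ordS a)).
  by apply/bigcupsP => M _; apply/subsetP => e; rewrite inE => /andP[].
apply/bigcupP => -[M]; rewrite !inE => /andP[ne_M /imsetP[k _ M_k]].
rewrite {}M_k in ne_M * => /andP[_ /edge_sub_cover_colour_class].
case=> [kh|[b /ordS_inj <- [ak SSak]]].
  by rewrite -kh Sah eqxx in ne_M.
by rewrite ak SSak eqxx in ne_c.
Qed.

Lemma trivIset_colour_class h : trivIset (colour_class h).
Proof.
apply/trivIsetP => _ _ /imsetP[i + ->] /imsetP[j + ->]; rewrite !inE.
move=> /eqP ih /eqP jh ne_ij; rewrite -setI_eq0; apply/eqP/setP => v.
rewrite !inE; apply/negP => /andP[/orP[] /eqP-> /orP[] /eqP].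
- by move=> ij; rewrite ij eqxx in ne_ij.
- by move=> ij; have := c_proper j; rewrite -ij ih jh eqxx.
- by move=> ij; have := c_proper i; rewrite ij ih jh eqxx.
by move/ordS_inj => ij; rewrite ij eqxx in ne_ij.
Qed.

Hypothesis c_surj : forall h, exists i, c i = h.

Lemma colour_class_inj : injective colour_class.
Proof.
move=> h k eq_hk; have [i ih] := c_surj h.
have := mem_colour_class k i; rewrite -eq_hk mem_colour_class ih eqxx.
by move/esym/eqP.
Qed.

Lemma partition_colour_classes :
  partition (parts colour_class) (gedge (cycle_graph m)).
Proof.
apply/and3P; split.
- apply/eqP/setP => e; apply/bigcupP/(gedge_cycleP m_gt2).
    by case=> _ /imsetP[h _ ->] /imsetP[i _ ->]; exists i.
  move=> [i ->]; exists (colour_class (c i)); first exact: imset_f.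
  by rewrite mem_colour_class.
- apply/trivIsetP => _ _ /imsetP[h _ ->] /imsetP[k _ ->] ne_hk.
  rewrite -setI_eq0; apply/eqP/setP => e; rewrite !inE; apply/negP.
  case/andP=> /imsetP[i + ->]; rewrite inE mem_colour_class => /eqP-> /eqP hk.
  by rewrite hk eqxx in ne_hk.
apply/imsetP => -[h _ /setP/= eq0]; have [i ih] := c_surj h.
by have := eq0 (cycle_edge i); rewrite mem_colour_class ih eqxx inE.
Qed.

Lemma gedge_del_colours (h : 'I_p) i :
  (cycle_edge i \in gedge (del_edges (cycle_graph m)
      (\bigcup_(k : 'I_p | (k < h)%N) colour_class k))) = (h <= c i)%N.
Proof.
rewrite inE (cycle_edge_gedge m_gt2) andbT leqNgt; congr (~~ _).
apply/bigcupP/idP => [[k lt_kh]|lt_h].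
  by rewrite mem_colour_class => /eqP->.
by exists (c i); rewrite ?mem_colour_class.
Qed.

Lemma positive_colour_class (h : 'I_p) (w : 'I_m -> R) :
  (forall i, (h <= c i)%N -> 0 < w i + w (ordS i) <-> c i = h) ->
  positive_matching R (del_edges (cycle_graph m)
    (\bigcup_(k : 'I_p | (k < h)%N) colour_class k)) (colour_class h).
Proof.
move=> w_pos; split; [split; last exact: trivIset_colour_class|exists w].
  apply/subsetP => e /imsetP[i + ->]; rewrite inE => /eqP ih.
  by rewrite gedge_del_colours ih.
move=> u v uvE; have : [set u; v]%SET \in gedge (cycle_graph m).
  by move: uvE; rewrite inE => /andP[].
case/(gedge_cycleP m_gt2)=> i uv_i; rewrite uv_i gedge_del_colours in uvE *.
rewrite mem_colour_class; have := w_pos i uvE.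
have -> : w u + w v = w i + w (ordS i).
  by case: (set2_cycle_edge m_gt2 uv_i) => -[-> ->]; rewrite // addrC.
by move=> wP; split=> [/wP->|/eqP/wP].
Qed.

(* An induced matching: weight 1 on its vertices and -2 elsewhere. *)
Lemma induced_weight h :
  (forall a, c a = h -> c (ordS (ordS a)) <> h) ->
  exists w : 'I_m -> R, forall i, 0 < w i + w (ordS i) <-> c i = h.
Proof.
move=> ind_h; pose V := cover (colour_class h).
exists (fun v => if v \in V then 1 else - 2) => i.
have -> : (0 < (if i \in V then 1 else - 2) +
               (if ordS i \in V then 1 else - 2) :> R) =
    (cycle_edge i \subset V).
  rewrite subUset !sub1set; case: (i \in V); case: (ordS i \in V); lra.
split=> [/edge_sub_cover_colour_class[//|[a -> [ah SSah]]]|ih].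
  by case: (ind_h a ah).
by apply: subset_cover; rewrite mem_colour_class ih.
Qed.

(* Along the path obtained by deleting edge 0 the sums of the weights over
   the edges can be prescribed freely. *)
Lemma path_weight (s : 'I_m -> bool) :
  exists w : 'I_m -> R,
    forall i : 'I_m, (0 < i)%N -> 0 < w i + w (ordS i) <-> s i.
Proof.
pose sgn k : R := if insub k is Some i then if s i then 1 else -1 else 0.
pose W := fix W k := if k is k'.+1 then sgn k' - W k' else 0.
(* Vertex 0 is the far end of the path and carries [W m], so that edge [m - 1] also receives its
   prescribed sum. *)
exists (fun v => if (v == 0 :> nat)%N then W m else W v) => i i_gt0.
have -> : (if (ordS i == 0 :> nat)%N then W m else W (ordS i)) = W i.+1.
  by rewrite val_ordS; case: (altP (i.+1 =P m)) => [->|].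
rewrite eqn0Ngt i_gt0 /= addrC subrK /sgn valK.
by case: (s i); rewrite ?ltr01 ?ltr0N1.
Qed.

(** The second hypothesis makes class 0 an induced matching, positive in the whole cycle. By the
    first, edge 0 disappears with it, so the later classes live on a path. *)
Lemma pmd_colour_classes :
  (forall i : 'I_m, i = 0 :> nat -> c i = 0 :> nat) ->
  (forall a, c a = 0 :> nat -> c (ordS (ordS a)) <> 0 :> nat) ->
  pmd R (cycle_graph m) colour_class.
Proof.
move=> c0 ind0; split; [exact: colour_class_inj|exact: partition_colour_classes|].
move=> h; have [h0|h_gt0] := posnP h.
  have [w wP] : exists w : 'I_m -> R,
      forall i, 0 < w i + w (ordS i) <-> c i = h.
    apply: induced_weight => a ah SSah; apply: (ind0 a); by rewrite ?ah ?SSah.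
  by apply: (positive_colour_class (w := w)) => i _.
have [w wP] := path_weight (fun i => c i == h).
apply: (positive_colour_class (w := w)) => i le_h.
have i_gt0 : (0 < i)%N.
  by rewrite lt0n; apply: contraTneq le_h => /c0->; rewrite -ltnNge.
by have := wP i i_gt0 => -[w1 w2]; split=> [/w1/eqP|ih] //; apply/w2/eqP.
Qed.
End Colouring.

(* Around the cycle: 0, 1, ..., p-1, then p-3 if m - p is odd, then
   p-2, p-1, ..., p-2, p-1. *)
Definition cycle_colour (m p i : nat) : nat :=
  if (i < p)%N then i
  else if (i == p) && odd (m - p) then (p - 3)%N
  else if odd (m - i) then p.-1 else p.-2.

(** * The explicit colouring and its omittable colours *)

Section CycleColouring.
Variables (m p : nat) (p_gt2 : (2 < p)%N) (le_pm : (p <= m)%N).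
Let m_gt2 : (2 < m)%N := leq_trans p_gt2 le_pm.

Lemma cycle_colour_lt (i : 'I_m) : (cycle_colour m p i < p)%N.
Proof. by rewrite /cycle_colour; have := ltn_ord i; do !case: ifP; lia. Qed.

Definition cycle_colouring (i : 'I_m) : 'I_p := Ordinal (cycle_colour_lt i).

Lemma val_cycle_colouring i : cycle_colouring i = cycle_colour m p i :> nat.
Proof. by []. Qed.

Hypothesis not43 : ~ (m = 4 /\ p = 3).

(** The delicate case is [m = p + 1], where edge [p], of colour [p - 3], meets edge 0: the colours
    agree only for [p = 3], which [not43] excludes. *)
Lemma cycle_colouring_proper i : cycle_colouring (ordS i) != cycle_colouring i.
Proof.
apply/eqP => /(congr1 (@nat_of_ord p)).
rewrite !val_cycle_colouring val_ordS /cycle_colour.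
have := ltn_ord i; case: eqP; do !case: ifP; lia.
Qed.

Lemma cycle_colouring_surj h : exists i, cycle_colouring i = h.
Proof.
exists (widen_ord le_pm h); apply: val_inj => /=.
by rewrite /cycle_colour /= ltn_ord.
Qed.

(** Colour 0 recurs only on edge 3, when [p = 3] and [m] is even; then [m >= 6], so edges 0 and 3
    are three or more steps apart both ways. *)
Lemma cycle_colouring_induced0 i :
  cycle_colouring i = 0 :> nat -> cycle_colouring (ordS (ordS i)) <> 0 :> nat.
Proof.
rewrite !val_cycle_colouring val_ordS2 // /cycle_colour.
have := ltn_ord i; do !case: ifP; lia.
Qed.

Lemma cycle_colouring_omit (h : 'I_p) : (0 < h)%N \/ ~ (m = 5 /\ p = 4) ->
  exists2 a, cycle_colouring (ordS a) = h
    & cycle_colouring a != cycle_colouring (ordS (ordS a)).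
Proof.
move=> good; have h_lt := ltn_ord h.
have step a : (a < m)%N ->
    let b := if (a.+1 == m)%N then 0%N else a.+1 in
    let b' := if (a.+1 == m)%N then 1%N
              else if (a.+2 == m)%N then 0%N else a.+2 in
    cycle_colour m p b = h -> cycle_colour m p a <> cycle_colour m p b' ->
    exists2 a, cycle_colouring (ordS a) = h
      & cycle_colouring a != cycle_colouring (ordS (ordS a)).
  move=> a_lt b b' b_h ne_ab'; exists (Ordinal a_lt).
    by apply: val_inj; rewrite [LHS]val_cycle_colouring val_ordS.
  apply/eqP => /(congr1 (@nat_of_ord p)).
  by rewrite !val_cycle_colouring val_ordS2.
have [h0|h_gt0] := posnP h.
  (* Edge 0 has neighbours 1, of colour 1, and [m - 1], of colour [p - 1], or [p - 3] if
     [m = p + 1]. The latter equals 1 only for [(m, p) = (5, 4)]. *)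
  apply: (step m.-1); first by lia.
    by rewrite prednK ?eqxx ?h0 /cycle_colour ?(ltnW (ltnW p_gt2)) //; lia.
  rewrite prednK ?eqxx /cycle_colour; last by lia.
  by rewrite (ltnW p_gt2); do !case: ifP; lia.
have [h_last|h_mid] := boolP ((h == p.-1 :> nat) && (m != p.+1)).
  (* Edge [m - 1] has colour [p - 1], and its neighbours have colours [p - 2] and 0. *)
  apply: (step m.-2); first by lia.
    have -> : (m.-2.+1 == m) = false by lia.
    by rewrite /cycle_colour; do !case: ifP; lia.
  have -> : (m.-2.+1 == m) = false by lia.
  have -> : m.-2.+2 == m by lia.
  by rewrite /cycle_colour (ltnW (ltnW p_gt2)); do !case: ifP; lia.
have h1m : (h.-1.+1 == m) = false by lia.
(* Edge [h] has neighbours of colours [h - 1] and [h + 1], the latter replaced by [p - 3] if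
   [h = p - 1] and [m = p + 1]. *)
apply: (step h.-1); first by lia.
  by rewrite h1m prednK // /cycle_colour h_lt.
rewrite h1m prednK // /cycle_colour; have -> : (h.-1 < p)%N by lia.
by case: eqP; do !case: ifP; lia.
Qed.

Lemma pmd_cycle_colouring (R : realType) :
  pmd R (cycle_graph m) (colour_class cycle_colouring).
Proof.
apply: pmd_colour_classes => //.
- exact: cycle_colouring_proper.
- exact: cycle_colouring_surj.
- by move=> i i0; rewrite /= i0 /cycle_colour (ltnW (ltnW p_gt2)).
exact: cycle_colouring_induced0.
Qed.

(** The map [h] selects the colours to be omitted in rotation: all [p] of them in general, only the
    nonzero ones for [(m, p) = (5, 4)]. *)
Lemma AFE_covering_cycle_colouring n q (h : 'I_q -> 'I_p) N :
  (1 < q)%N -> injective h ->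
  (forall i, (0 < h i)%N \/ ~ (m = 5 /\ p = 4)) -> (q * n <= N * q.-1)%N ->
  exists C : 'I_N -> {set {set {set 'I_m}}},
    AFE_covering (cycle_graph m) n (parts (colour_class cycle_colouring)) C.
Proof.
move=> q_gt1 h_inj good.
apply: (AFE_covering_rotation (h := colour_class cycle_colouring \o h)) => //.
- by apply: inj_comp h_inj; apply: colour_class_inj m_gt2 _ cycle_colouring_surj.
- by move=> i; apply: imset_f.
move=> i; have [a] := cycle_colouring_omit (good i).
exact: AFE_omit_colour.
Qed.
End CycleColouring.

Theorem proposition3p2 (R : realType) (n m p : nat)
  (hn : (1 <= n)%N) (hp : (3 <= p)%N) (hpm : (p <= m)%N)
  (hmp : (m, p) <> (4, 3)%N) :
  ((m, p) <> (5, 4)%N ->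
     kappa R (cycle_graph m) n p
     = (Num.ceil ((p%:R * n%:R) / (p%:R - 1) : R))%:~R%:E) /\
  ((m, p) = (5, 4)%N ->
     kappa R (cycle_graph m) n p
     = (Num.ceil ((3 * n%:R) / 2 : R))%:~R%:E).
Proof.
have m_gt2 := leq_trans hp hpm.
have not43 : ~ (m = 4 /\ p = 3) by move=> [m4 p3]; apply: hmp; rewrite m4 p3.
have pmdC := pmd_cycle_colouring hp hpm not43 R.
split=> [not54|[m5 p4]].
  have -> : p%:R - 1 = p.-1%:R :> R by rewrite -subn1 natrB // ltnW // ltnW.
  apply: kappa_eq_ceil; first exact: ltnW.
    by move=> M pmdM N C; apply: cycle_AFE_covering_bound pmdM _ _ _.
  exists (colour_class (cycle_colouring hp hpm)) => // N.
  apply: (AFE_covering_cycle_colouring hp hpm not43 (h := id)) => //.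
    exact: ltnW.
  by right => -[m5 p4]; apply: not54; rewrite m5 p4.
move: hp hpm pmdC; rewrite {}m5 {}p4 in not43 * => hp hpm pmdC.
apply: (@kappa_eq_ceil _ _ n R 4 3) => //.
  by move=> M pmdM N C; apply: C5_AFE_covering_bound pmdM.
exists (colour_class (cycle_colouring hp hpm)) => // N.
(* [lift ord0] enumerates the three nonzero colours. *)
apply: (AFE_covering_cycle_colouring hp hpm not43 (h := lift ord0)) => //.
  exact: lift_inj.
by left.
Qed.
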